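(* The enumeration algorithm for efficient vertices of (vLP) described in the context, started from any efficient vertex $x^0$ of $P$ given by a regular basic feasible solution, terminates after finitely many steps and returns the set of all efficient vertices of $P$ (the vertices of $P$ that are efficient solutions of (vLP)), each specified by an associated regular basic feasible solution.
   Context: Model (vMDP). Integers $T\geq 2$, $S\ge 1$, $k\geq 1$; states $\mathbb S=\{1,\dots,S\}$; action sets $\mathbb A_s=\{1,\dots,k_s\}$ with $k_s\ge1$ and $k_s>1$ for at least one $s$; transition probabilities $p_t(j|s,a)$ for $t=1,\dots,T-1$, $s,j\in\mathbb S$, $a\in\mathbb A_s$ (nonnegative, summing to 1 over $j$); rewards $R_t(s,a)\in\mathbb R^k$ ($t<T$) and $R_T(s)\in\mathbb R^k$; initial probabilities $\alpha(s)>0$ with $\sum_{s}\alpha(s)=1$. $P$ is the polyhedron of all $x\geqq0$ (componentwise) with components $x_t(s,a)$ ($t\le T-1$, $s\in\mathbb S$, $a\in\mathbb A_s$) and $x_T(s)$ satisfying (a) $\sum_{a\in\mathbb A_j}x_1(j,a)=\alpha(j)$ for all $j$; (b) $\sum_{a\in\mathbb A_j}x_{t+1}(j,a)=\sum_{s}\sum_{a\in\mathbb A_s}p_t(j|s,a)x_t(s,a)$ for all $j$ and $t=1,\dots,T-2$; (c) $x_T(j)=\sum_{s}\sum_{a\in\mathbb A_s}p_{T-1}(j|s,a)x_{T-1}(s,a)$ for all $j$. Write (a)-(c) as $Ax=b$ with $m=ST$ rows. Program (vLP): vector-maximize $f(x)=\sum_{t=1}^{T-1}\sum_{s}\sum_{a}x_t(s,a)R_t(s,a)+\sum_s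 x_T(s)R_T(s)\in\mathbb R^k$ over $x\in P$; $x^*\in P$ is an efficient solution if there is no $x\in P$ with $f(x)\geqq f(x^* )$ and $f(x)\neq f(x^* )$. Regular basic feasible solutions. Given a selection of one action $a_{st}\in\mathbb A_s$ for each $s\in\mathbb S$ and $t=1,\dots,T-1$, let $B$ consist of the $m$ indices $(t,s,a_{st})$ and $(T,s)$. The associated basic solution (the unique $x$ with $Ax=b$ and $x_t(s,a')=0$ for all $a'\neq a_{st}$) is nonnegative and is called a regular basic feasible solution, with basis $B$. Every vertex of $P$ admits a representation as a regular basic feasible solution. Algorithm. Two vertices of $P$ are adjacent if they are joined by an edge of $P$. Input: an efficient vertex $x^0$ given by a regular basic feasible solution. Step 1: put $\mathscr L=\{x^0\}$, $\mathscr E=\{x^0\}$. Step 2: if $\mathscr L=\emptyset$, stop and return $\mathscr E$. Step 3: choose a vertex $x\in\mathscr L$ with its associated regular basic feasible solution and remove it from $\mathscr L$. Step 4: test every vertex $x'\notin\mathscr E$ adjacent to $x$, represented by an associated regular basic feasible solution, for efficiency (i.e. decide whether $x'$ is an efficient solution of (vLP)); add those found efficient to both $\mathscr E$ and $\mathscr L$; return to Step 2. *)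

(* Defs.v *)
From HB Require Import structures.
From mathcomp Require Import all_boot all_order all_algebra finmap.
From mathcomp Require Import boolp classical_sets reals.

Set Implicit Arguments.
Unset Strict Implicit.
Unset Printing Implicit Defensive.

Import Order.TTheory GRing.Theory Num.Theory.

Local Open Scope ring_scope.

(* States and actions are numbered from 0.  An element t of 'I_(horizon.-1)
   stands for the decision epoch t + 1, so that it ranges over 1, ..., T - 1. *)
Record vMDP (R : realType) := VMDP {
  horizon : nat;
  nstate : nat;
  nobj : nat;
  nact : 'I_nstate -> nat;
  ptrans : 'I_horizon.-1 -> forall s : 'I_nstate, 'I_(nact s) -> 'I_nstate -> R;
  reward : 'I_horizon.-1 -> forall s : 'I_nstate, 'I_(nact s) -> 'rV[R]_nobj;
  reward_end : 'I_nstate -> 'rV[R]_nobj;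
  alpha : 'I_nstate -> R;
  horizon_ge2 : (2 <= horizon)%N;
  nstate_ge1 : (1 <= nstate)%N;
  nobj_ge1 : (1 <= nobj)%N;
  nact_ge1 : forall s, (1 <= nact s)%N;
  nact_gt1 : exists s, (1 < nact s)%N;
  trans_ge0 : forall t s (a : 'I_(nact s)) j, 0 <= ptrans t a j;
  trans_sum1 : forall t s (a : 'I_(nact s)), \sum_j ptrans t a j = 1;
  alpha_gt0 : forall s, 0 < alpha s;
  alpha_sum1 : \sum_s alpha s = 1
}.

Section Model.
Context {R : realType} (M : vMDP R).

Local Notation epoch := 'I_(horizon M).-1.
Local Notation state := 'I_(nstate M).

(* [inl (t, (s, a))] indexes the component x_t(s, a), [inr s] indexes x_T(s). *)
Definition comp_index : finType :=
  ((epoch * {s : state & 'I_(nact s)}) + state)%type.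

Definition occupancy : choiceType := {ffun comp_index -> R}.

Definition xact (x : occupancy) (t : epoch) (s : state) (a : 'I_(nact s)) : R :=
  x (inl (t, Tagged (fun s => 'I_(nact s)) a)).

Definition xend (x : occupancy) (s : state) : R := x (inr s).

Definition inflow (x : occupancy) (t : epoch) (j : state) : R :=
  \sum_(s : state) \sum_(a : 'I_(nact s)) ptrans t a j * xact x t a.

Definition outflow (x : occupancy) (t : epoch) (j : state) : R :=
  \sum_(a : 'I_(nact j)) xact x t a.

(* The system A x = b. *)
Definition balanced (x : occupancy) : Prop :=
  [/\ forall (t : epoch) j, t = 0%N :> nat -> outflow x t j = alpha j,
      forall (t u : epoch) j, u = t.+1 :> nat -> outflow x u j = inflow x t j
    & forall (t : epoch) j, t.+1 = (horizon M).-1 -> xend x j = inflow x t j].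

Definition polyhedron : set occupancy :=
  [set x | balanced x /\ forall i, 0 <= x i].

Definition objective (x : occupancy) : 'rV[R]_(nobj M) :=
  \sum_(t : epoch) \sum_(s : state) \sum_(a : 'I_(nact s))
     xact x t a *: reward t a
  + \sum_(s : state) xend x s *: reward_end s.

Definition efficient (x : occupancy) : Prop :=
  polyhedron x /\
  ~ exists y, [/\ polyhedron y,
                  forall i, objective x 0 i <= objective y 0 i
                & objective y <> objective x].

Definition face (F : set occupancy) : Prop :=
  exists (c : occupancy) (delta : R),
    (forall x, polyhedron x -> \sum_i c i * x i <= delta) /\
    F = [set x | polyhedron x /\ \sum_i c i * x i = delta]%classic.

Definition vertex (x : occupancy) : Prop := face [set x]%classic.

(* A face whose affine hull is a line. *)
Definition edge (F : set occupancy) : Prop :=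
  face F /\
  exists x y, [/\ F x, F y, x <> y &
    forall z, F z -> exists r : R, forall i, z i = x i + r * (y i - x i)].

Definition adjacent (x y : occupancy) : Prop :=
  [/\ vertex x, vertex y, x <> y & exists F, [/\ edge F, F x & F y]].

Definition selection : finType :=
  {dffun forall ts : epoch * state, 'I_(nact ts.2)}.

Definition basis (d : selection) : {set comp_index} :=
  [set i : comp_index | match i with
                   | inl (t, sa) => tagged sa == d (t, tag sa)
                   | inr _ => true
                   end].

Definition regular_bfs (d : selection) (x : occupancy) : Prop :=
  [/\ balanced x, forall i, i \notin basis d -> x i = 0
    & forall i, 0 <= x i].

(* A point together with the selection that is meant to represent it. *)
Definition node : choiceType := (occupancy * selection)%type.

Definition vertices_of (E : {fset node}) : {fset occupancy} :=
  [fset nd.1 | nd in E]%fset.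

Record alg_state := AlgState { pending : {fset node}; found : {fset node} }.

Definition initial (nd : node) : alg_state :=
  AlgState [fset nd]%fset [fset nd]%fset.

(* [tested] consists of the vertices adjacent to [x] that [E] does not contain,
   each represented by one regular basic feasible solution; the test against [E]
   compares vertices, not the selections representing them. *)
Definition tests (x : occupancy) (E tested : {fset node}) : Prop :=
  [/\ forall nd, nd \in tested ->
        [/\ adjacent x nd.1, nd.1 \notin vertices_of E & regular_bfs nd.2 nd.1],
      forall y, adjacent x y -> y \notin vertices_of E -> y \in vertices_of tested
    & {in tested &, injective (fun nd : node => nd.1)}].

(* One iteration of the main loop, in which [nd] is the pending vertex chosen. The
   efficiency test is an oracle, and the choice of [tested] is left open. *)
Definition pass (nd : node) (st st' : alg_state) : Prop :=
  nd \in pending st /\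
  exists2 tested, tests nd.1 (found st) tested &
    let new := [fset nd' in tested | `[< efficient nd'.1 >]]%fset in
    st' = AlgState ((pending st `\ nd) `|` new)%fset (found st `|` new)%fset.

Inductive reachable (st : alg_state) : alg_state -> Prop :=
| reachable_refl : reachable st st
| reachable_pass st1 st2 nd :
    reachable st st1 -> pass nd st1 st2 -> reachable st st2.

End Model.

(* Main.v *)
Require Import Defs.
From HB Require Import structures.
From mathcomp Require Import all_boot all_order all_algebra finmap.
From mathcomp Require Import boolp classical_sets reals.
From mathcomp Require Import ring lra.

(** A selection of actions sends the initial distribution through the process and
    so determines one point of the polyhedron, its basic solution; the other points
    randomize between actions.  For a linear criterion c, the values of the selection
    at the places (t, s) turn c into reduced costs, the advantages of the single
    actions ([lin_value]).  If no advantage is positive, the selection is c-optimal;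
    if one is, replacing one action of the selection by the profitable one improves
    the criterion, and, unless the action is taken at a place that is never visited,
    leads to a vertex adjacent to the first ([adjacent_switch]).  Unvisited places are
    the degeneracy of this linear program.  They are dealt with by choosing, among
    all selections with the same basic solution, one that is best when mass is
    injected at every place.  Hence every vertex is a regular basic feasible solution
    ([vertex_policy]), and a vertex that is not c-optimal has a strictly better
    neighbour ([improving_neighbour]).

    By Farkas' lemma, a point is efficient exactly if it maximizes the objective
    weighted by some positive weights ([efficient_weights], [optimal_efficient]).
    Applied to a slightly perturbed criterion, the existence of improving neighbours
    shows that inside the face of optimal solutions of c, where every point is
    efficient if c comes from positive weights, one can walk along edges to the
    maximum of any second criterion ([face_walk]).  Now let two efficient
    vertices be optimal for the weights lam0 and lam1, and move the weights from lam0
    to lam1 along the segment between them.  As long as the optimal vertex remains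
    optimal nothing has to be done; when it ceases to be, a walk in the optimal face
    of the current weights leads to a vertex that is optimal further on.  At lam1, a
    last walk reaches the second vertex, as it is the unique maximizer of some linear
    criterion.  So the efficient vertices are connected by edges through efficient
    vertices ([efficient_connected]).

    The rest is a graph search.  When no vertex is pending, the set found is closed
    under passing to efficient neighbours, hence contains all efficient vertices.
    Each iteration finishes one more found vertex, and there are at most as many
    vertices as selections, so the search ends. *)

(** * Linear forms, Farkas' lemma and acyclic systems *)

Section LinearForms.
Set Implicit Arguments.
Unset Strict Implicit.
Import Order.TTheory GRing.Theory Num.Theory.
Local Open Scope ring_scope.

Definition lin (R : realFieldType) (J : finType) (c x : J -> R) : R :=
  \sum_j c j * x j.

Lemma lin_comb (R : realFieldType) (J : finType) (c x y : J -> R) (r s : R) :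
  lin c (fun j => r * x j + s * y j) = r * lin c x + s * lin c y.
Proof.
rewrite /lin !mulr_sumr -big_split /=; apply: eq_bigr => j _; ring.
Qed.

Lemma lin_combl (R : realFieldType) (J : finType) (c e x : J -> R) (r s : R) :
  lin (fun j => r * c j + s * e j) x = r * lin c x + s * lin e x.
Proof.
rewrite /lin !mulr_sumr -big_split /=; apply: eq_bigr => j _; ring.
Qed.

(** The proof is by induction on the number of forms.  If the form [A k0] is
    redundant, it gets the coefficient 0.  Otherwise some x' violates the
    conclusion once [A k0] is dropped; then [A k0] is positive at x', and projecting
    all forms along x' onto the kernel of [A k0] removes this form. *)
Lemma farkas (R : realFieldType) (J K : finType) (A : K -> J -> R) (c : J -> R)
    (P : {set K}) :
    (forall x : J -> R, (forall k, k \in P -> lin (A k) x <= 0) -> lin c x <= 0) ->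
  exists2 lam : K -> R, forall k, 0 <= lam k &
    forall j, c j = \sum_(k in P) lam k * A k j.
Proof.
move: {2}#|P| (erefl #|P|) => m; elim: m P A c => [|m IHm] P A c cardP hyp.
  have P0 := card0_eq cardP.
  exists (fun=> 0) => // j; rewrite big_pred0 //.
  have pos := hyp (fun i => c j * (i == j)%:R) _.
  have : lin c (fun i => c j * (i == j)%:R) <= 0.
    by apply: pos => k; rewrite P0 inE.
  rewrite /lin (bigD1 j) //= eqxx mulr1 big1 ?addr0; last first.
    by move=> i /negbTE->; rewrite !mulr0.
  by rewrite -expr2 => c2; apply/eqP; rewrite -sqrf_eq0 eq_le c2 sqr_ge0.
have [k0 k0P] : exists k0, k0 \in P by apply/card_gt0P; rewrite cardP.
have cardP' : #|P :\ k0| = m by move: cardP; rewrite (cardsD1 k0) k0P => -[].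
have [red|] := pselect (forall x : J -> R,
    (forall k, k \in P :\ k0 -> lin (A k) x <= 0) -> lin c x <= 0).
  have [lam lam_ge0 lamE] := IHm _ _ _ cardP' red.
  exists (fun k => if k == k0 then 0 else lam k) => [k|j]; first by case: ifP.
  rewrite lamE [RHS](bigD1 k0) //= eqxx mul0r add0r.
  apply: eq_big => [k|k]; first by rewrite !inE andbC.
  by rewrite !inE => /andP[/negbTE->].
(* [proj e] is e composed with the projection onto the kernel of [A k0] along x'. *)
move=> /existsNP[x' /not_implyP[x'P /negP]]; rewrite -ltNge => cx'.
have Ax' : 0 < lin (A k0) x'.
  rewrite ltNge; apply/negP => Ax'; move: cx'; rewrite ltNge hyp // => k kP.
  by have [->//|kk0] := eqVneq k k0; apply: x'P; rewrite !inE kk0.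
set a := lin (A k0) x' in Ax' *.
pose proj (e : J -> R) j := 1 * e j + (- (lin e x' / a)) * A k0 j.
have projE e x : lin (proj e) x = lin e (fun j => 1 * x j + (- (lin (A k0) x / a)) * x' j).
  rewrite lin_comb /proj (lin_combl e (A k0) x); ring.
have red x : (forall k, k \in P :\ k0 -> lin (proj (A k)) x <= 0) ->
    lin (proj c) x <= 0.
  move=> xP; rewrite projE; apply: hyp => k kP.
  have [->|kk0] := eqVneq k k0; last by rewrite -projE xP // !inE kk0.
  by rewrite lin_comb -/a mulNr divfK ?gt_eqF // mul1r addrN.
have [lam lam_ge0 lamE] := IHm _ (fun k => proj (A k)) (proj c) cardP' red.
pose mu := lin c x' / a - \sum_(k in P :\ k0) lam k * (lin (A k) x' / a).
exists (fun k => if k == k0 then mu else lam k) => [k|j].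
  case: ifP => // _; rewrite subr_ge0 (@le_trans _ _ 0) //; last first.
    by rewrite divr_ge0 // ltW.
  apply: sumr_le0 => l lP.
  by rewrite mulr_ge0_le0 // mulr_le0_ge0 // ?x'P // invr_ge0 ltW.
have := lamE j; rewrite /proj => /eqP; rewrite mul1r mulNr subr_eq => /eqP->.
rewrite [RHS](bigD1 k0) //= eqxx /mu.
have -> : \sum_(i in P | i != k0) (if i == k0 then mu else lam i) * A i j =
    \sum_(k in P :\ k0) lam k * A k j.
  apply: eq_big => [k|k]; first by rewrite !inE andbC.
  by move=> /andP[_ /negbTE->].
rewrite mulrBl [LHS]addrC -addrA; congr (_ + _).
rewrite addrC mulr_suml -sumrN -big_split /=; apply: eq_bigr => k _; ring.
Qed.

(** The system is triangular for the rank, so it is solved rank by rank. *)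
Lemma acyclic_system (R : pzRingType) (N : finType) (rank : N -> nat)
    (Q : N -> N -> R) (b : N -> R) :
    (forall j k, Q j k != 0 -> (rank k < rank j)%N) ->
  exists y : N -> R, forall j, y j = b j + \sum_k Q j k * y k.
Proof.
move=> acyc.
have [y yE] : exists y : N -> R, forall j,
    (rank j < (\max_j rank j).+1)%N -> y j = b j + \sum_k Q j k * y k.
  elim: (\max_j rank j).+1 => [|m [y yE]]; first by exists (fun=> 0).
  exists (fun j => if (rank j < m)%N then y j else b j + \sum_k Q j k * y k).
  move=> j jm /=; transitivity (b j + \sum_k Q j k * y k).
    by case: ifP => // /yE.
  congr (_ + _); apply: eq_bigr => k _; have [->|/acyc kj] := eqVneq (Q j k) 0.
    by rewrite !mul0r.
  by rewrite (leq_trans kj).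
by exists y => j; apply: yE; rewrite ltnS leq_bigmax.
Qed.

Lemma acyclic_ind (N : finType) (rank : N -> nat) (C : N -> Prop) :
  (forall j, (forall k, (rank k < rank j)%N -> C k) -> C j) -> forall j, C j.
Proof.
move=> IH j; move: {2}(rank j).+1 (ltnSn (rank j)) => m.
elim: m j => // m IHm j jm; apply: IH => k kj; apply: IHm.
exact: leq_trans kj jm.
Qed.
End LinearForms.

(** * The polyhedron as a flow in an acyclic network *)

Section Network.
Set Implicit Arguments.
Unset Strict Implicit.
Import Order.TTheory GRing.Theory Num.Theory.
Local Open Scope ring_scope.
Context {R : realType} (M : vMDP R).
Local Notation epoch := 'I_(horizon M).-1.
Local Notation state := 'I_(nstate M).
Local Notation index := (comp_index M).

(** A place is a pair of an epoch and a state, the final epoch included.  Over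
    places the three kinds of balance equations become one, see [balancedE]. *)
Definition place : finType := (epoch * state + state)%type.

Definition act (t : epoch) (s : state) (a : 'I_(nact s)) : index :=
  inl (t, Tagged (fun s => 'I_(nact s)) a).

Definition place_of (i : index) : place :=
  match i with inl (t, sa) => inl (t, tag sa) | inr s => inr s end.

Definition step (i : index) (j : place) : R :=
  match i, j with
  | inl (t, sa), inl (u, s) => if u == t.+1 :> nat then ptrans t (tagged sa) s else 0
  | inl (t, sa), inr s => if t.+1 == (horizon M).-1 then ptrans t (tagged sa) s else 0
  | inr _, _ => 0
  end.

Definition supply (j : place) : R :=
  match j with
  | inl (t, s) => if t == 0%N :> nat then alpha s else 0
  | inr _ => 0
  end.

Definition state_of (j : place) : state :=
  match j with inl (_, s) => s | inr s => s end.

Definition rank (j : place) : nat :=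
  match j with inl (t, _) => t | inr _ => (horizon M).-1 end.

Definition follow (d : selection M) (j : place) : index :=
  match j with inl (t, s) => act t (d (t, s)) | inr s => inr s end.

(** The injection b is a parameter because flows fed at every place, and not only
    at the first epoch, serve to handle places that are never visited. *)
Definition conserves (b : place -> R) (x : index -> R) : Prop :=
  forall j, \sum_(i | place_of i == j) x i = b j + \sum_i step i j * x i.

Lemma followK d j : place_of (follow d j) = j.
Proof. by case: j => [[]|]. Qed.

Lemma step_ge0 i j : 0 <= step i j.
Proof.
case: i j => [[t [s a]]|s] [[u s']|s'] //=; case: ifP => // _; exact: trans_ge0.
Qed.

Lemma step_rank i j : step i j != 0 -> (rank (place_of i) < rank j)%N.
Proof.
case: i j => [[t [s a]]|s] [[u s']|s'] //=; rewrite ?eqxx //;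
  by case: ifP => [/eqP->|]; rewrite ?eqxx.
Qed.

Lemma supply_ge0 j : 0 <= supply j.
Proof. by case: j => [[t s]|s] //=; case: ifP => // _; rewrite ltW ?alpha_gt0. Qed.

Lemma sum_index (F : index -> R) :
  \sum_i F i = (\sum_(t : epoch) \sum_(s : state) \sum_(a : 'I_(nact s)) F (act t a))
    + \sum_(s : state) F (inr s).
Proof.
rewrite big_sumType /=; congr (_ + _).
transitivity (\sum_(t : epoch) \sum_(sa : {s : state & 'I_(nact s)}) F (inl (t, sa))).
  by rewrite pair_bigA; apply: eq_bigr => -[].
apply: eq_bigr => t _; rewrite sig_big_dep /=.
by apply: eq_bigr => -[].
Qed.

Lemma sum_place_act (F : index -> R) (t : epoch) (s : state) :
  \sum_(i | place_of i == inl (t, s)) F i = \sum_(a : 'I_(nact s)) F (act t a).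
Proof.
rewrite big_mkcond sum_index /= [X in _ + X]big1 // addr0.
rewrite (bigD1 t) //= (bigD1 s) //= eqxx.
rewrite [X in _ + X + _]big1 ?addr0; last first.
  move=> s' /negbTE s's; rewrite big1 // => a _.
  by case: eqP => // -[/eqP]; rewrite s's.
rewrite [X in _ + X]big1 ?addr0 //.
move=> t' /negbTE t't; rewrite big1 // => s' _; rewrite big1 // => a _.
by case: eqP => // -[/eqP]; rewrite t't.
Qed.

Lemma sum_place_end (F : index -> R) (s : state) :
  \sum_(i | place_of i == inr s) F i = F (inr s).
Proof.
rewrite (bigD1 (inr s)) //= big1 ?addr0 //.
by move=> [[t sa]|s'] //= /andP[/eqP[->]]; rewrite eqxx.
Qed.

Lemma sum_step (x : occupancy M) (t : epoch) (j : place) :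
    (forall u sa, step (inl (u, sa)) j =
       if u == t then ptrans t (tagged sa) (state_of j) else 0) ->
  \sum_i step i j * x i = inflow x t (state_of j).
Proof.
move=> stepE; rewrite sum_index.
have -> : \sum_(s : state) step (inr s) j * x (inr s) = 0.
  by apply: big1 => s _; rewrite /= mul0r.
rewrite addr0 -[RHS](big_pred1_eq +%R t (fun u => inflow x u _)) [RHS]big_mkcond.
apply: eq_bigr => u _; case: ifP => ut.
  by apply: eq_bigr => s _; apply: eq_bigr => a _; rewrite /act stepE ut (eqP ut).
by apply: big1 => s _; apply: big1 => a _; rewrite /act stepE ut mul0r.
Qed.

Lemma balancedE (x : occupancy M) : balanced x <-> conserves supply x.
Proof.
have T_gt0 : (0 < (horizon M).-1)%N by have := horizon_ge2 M; case: (horizon M) => [|[]].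
have first_in (u : epoch) s : u = 0%N :> nat -> \sum_i step i (inl (u, s)) * x i = 0.
  move=> u0; rewrite big1 // => -[[t sa]|s'] _ /=; last by rewrite mul0r.
  by rewrite u0 mul0r.
have later_in (t u : epoch) s : u = t.+1 :> nat ->
    \sum_i step i (inl (u, s)) * x i = inflow x t s.
  move=> ut; apply: (@sum_step x t (inl (u, s))) => v sa /=.
  rewrite ut eqSS eq_sym -val_eqE; case: eqP => // vt.
  by have -> : v = t by exact: val_inj.
have end_in (t : epoch) s : t.+1 = (horizon M).-1 ->
    \sum_i step i (inr s) * x i = inflow x t s.
  move=> tT; apply: (@sum_step x t (inr s)) => v sa /=.
  rewrite -[in X in _ == X]tT eqSS -val_eqE; case: eqP => // vt.
  by have -> : v = t by exact: val_inj.
split=> [[x1 xt xT] [[u s]|s]|xP].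
- rewrite sum_place_act /=; case: (posnP u) => [u0|u_gt0].
    by rewrite first_in // addr0; exact: x1.
  have tP : (u.-1 < (horizon M).-1)%N by rewrite (leq_ltn_trans (leq_pred _)).
  rewrite add0r (later_in (Ordinal tP)) /= ?prednK //.
  by apply: xt; rewrite /= prednK.
- have tP : ((horizon M).-1.-1 < (horizon M).-1)%N by rewrite prednK.
  rewrite sum_place_end /= add0r (end_in (Ordinal tP)) /= ?prednK //.
  by apply: xT; rewrite /= prednK.
- split=> [t s t0|t u s ut|t s tT].
  + by have := xP (inl (t, s)); rewrite sum_place_act first_in // addr0 /= t0.
  + by have := xP (inl (u, s)); rewrite sum_place_act (later_in t) //= ut add0r.
  + by have := xP (inr s); rewrite sum_place_end (end_in t) //= add0r.
Qed.

Lemma notin_basis (d : selection M) i : (i \notin basis d) = (i != follow d (place_of i)).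
Proof.
rewrite inE; case: i => [[t [s a]]|s] /=; last by rewrite eqxx.
congr (~~ _); apply/eqP/eqP => [->//|]; rewrite /act => -[/eqP].
by rewrite eq_Tagged => /eqP.
Qed.

(** The selection d, changed at the place of i only, so as to follow i there.  At a
    final place there is a single index and nothing to change. *)
Definition switch (d : selection M) (i : index) : selection M :=
  match i with
  | inl (t, sa) => [ffun ts => dfwith (T := fun ts : epoch * state => 'I_(nact ts.2))
                      d (i := (t, tag sa)) (tagged sa) ts]
  | inr _ => d
  end.

Lemma follow_switch d i j :
  follow (switch d i) j = if j == place_of i then i else follow d j.
Proof.
case: i => [[t [s a]]|s] /=; last by case: eqP => // ->.
case: j => [[u s']|s'] //=; rewrite ffunE; case: eqP => [[-> ->]|ne].
  by rewrite dfwith_in.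
by rewrite dfwith_out //; apply/eqP => -[tu ss]; apply: ne; rewrite tu ss.
Qed.

Lemma flow_exists b d : exists y : {ffun place -> R}, forall j,
  y j = b j + \sum_k step (follow d k) j * y k.
Proof.
have [|y yE] := @acyclic_system R place rank (fun j k => step (follow d k) j) b.
  by move=> j k /step_rank; rewrite followK.
by exists (finfun y) => j; rewrite ffunE yE; under eq_bigr do rewrite -(ffunE y).
Qed.

(** Following d, the mass that arrives at a place all goes to the index [follow d]
    of this place; [flow_exists] provides the masses. *)
Definition flow b d : occupancy M :=
  [ffun i => if i == follow d (place_of i)
             then projT1 (cid (flow_exists b d)) (place_of i) else 0].

Lemma flow_off b d i : i != follow d (place_of i) -> flow b d i = 0.
Proof. by rewrite ffunE => /negbTE->. Qed.

Lemma sum_place_follow (d : selection M) (F : index -> R) j :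
    (forall i, i != follow d (place_of i) -> F i = 0) ->
  \sum_(i | place_of i == j) F i = F (follow d j).
Proof.
move=> F0; rewrite (bigD1 (follow d j)) ?followK //= big1 ?addr0 //.
by move=> i /andP[/eqP<- ?]; exact: F0.
Qed.

Lemma sum_follow (d : selection M) (F : index -> R) :
    (forall i, i != follow d (place_of i) -> F i = 0) ->
  \sum_i F i = \sum_j F (follow d j).
Proof.
move=> F0; rewrite (partition_big place_of xpredT) //=.
by apply: eq_bigr => j _; exact: sum_place_follow.
Qed.

Lemma conserves_follow (d : selection M) b (x : index -> R) :
    (forall i, i != follow d (place_of i) -> x i = 0) ->
  conserves b x <->
  forall j, x (follow d j) = b j + \sum_k step (follow d k) j * x (follow d k).
Proof.
move=> x0; have inE j : \sum_i step i j * x i = \sum_k step (follow d k) j * x (follow d k).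
  by apply: (@sum_follow d (fun i => step i j * x i)) => i /x0->; rewrite mulr0.
by split=> xP j; have := xP j; rewrite inE (sum_place_follow _ x0).
Qed.

Lemma flow_conserves b d : conserves b (flow b d).
Proof.
apply: (conserves_follow b (@flow_off b d)).2 => j.
have massE k : flow b d (follow d k) = projT1 (cid (flow_exists b d)) k.
  by rewrite ffunE followK eqxx.
under eq_bigr do rewrite massE; rewrite massE.
exact: projT2 (cid (flow_exists b d)) j.
Qed.

Lemma conserves_unique d b (x y : index -> R) :
    conserves b x -> (forall i, i != follow d (place_of i) -> x i = 0) ->
    conserves b y -> (forall i, i != follow d (place_of i) -> y i = 0) ->
  forall i, x i = y i.
Proof.
move=> xb x0 yb y0; have {}xb := (conserves_follow b x0).1 xb.
have {}yb := (conserves_follow b y0).1 yb.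
have xy : forall j, x (follow d j) = y (follow d j).
  apply: (@acyclic_ind _ rank) => j IH; rewrite xb yb; congr (_ + _).
  apply: eq_bigr => k _; have [->|/step_rank] := eqVneq (step (follow d k) j) 0.
    by rewrite !mul0r.
  by rewrite followK => /IH->.
move=> i; have [->|ne] := eqVneq i (follow d (place_of i)); first exact: xy.
by rewrite x0 ?y0.
Qed.

Lemma flow_unique d b (x : occupancy M) :
    conserves b x -> (forall i, i != follow d (place_of i) -> x i = 0) ->
  x = flow b d.
Proof.
move=> xb x0; apply/ffunP; apply: (conserves_unique xb x0 (flow_conserves b d)).
exact: flow_off.
Qed.

Lemma flow_ge b d j : (forall k, 0 <= b k) -> b j <= flow b d (follow d j).
Proof.
move=> b0; have fE := (conserves_follow b (@flow_off b d)).1 (flow_conserves b d).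
move: j; apply: (@acyclic_ind _ rank) => j IH; rewrite fE lerDl.
apply: sumr_ge0 => k _; have [->|/step_rank] := eqVneq (step (follow d k) j) 0.
  by rewrite mul0r.
by rewrite followK => /IH ?; rewrite mulr_ge0 ?step_ge0 // (le_trans (b0 k)).
Qed.

Lemma flow_ge0 b d i : (forall k, 0 <= b k) -> 0 <= flow b d i.
Proof.
move=> b0; have [->|/flow_off->//] := eqVneq i (follow d (place_of i)).
by rewrite (le_trans (b0 _) (flow_ge _ _ b0)).
Qed.

(** The regular basic feasible solution with basis [basis d], see [regular_bfsE]. *)
Definition basic d := flow supply d.

Lemma basic_polyhedron d : polyhedron (basic d).
Proof.
split; first by apply/balancedE/flow_conserves.
by move=> i; exact: flow_ge0 supply_ge0.
Qed.

Lemma regular_bfsE d x : regular_bfs d x <-> x = basic d.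
Proof.
split=> [[/balancedE xb x0 _]|->].
  by apply: flow_unique => // i; rewrite -notin_basis; exact: x0.
have [? ?] := basic_polyhedron d; split=> // i.
by rewrite notin_basis; exact: flow_off.
Qed.

Lemma value_exists (c : index -> R) d : exists V : place -> R, forall j,
  V j = c (follow d j) + \sum_k step (follow d j) k * V k.
Proof.
apply: (@acyclic_system R place (fun j => (horizon M).-1 - rank j)%N
  (fun j k => step (follow d j) k)) => j k /step_rank; rewrite followK => jk.
have kT : (rank k <= (horizon M).-1)%N.
  by case: k {jk} => [[t s]|s] //=; exact: ltnW.
by rewrite ltn_sub2l // (leq_trans jk).
Qed.

Definition value c d : place -> R := projT1 (cid (value_exists c d)).

(** The reduced cost of i: what is gained by following i once before following d. *)
Definition advantage c d (i : index) : R :=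
  c i + \sum_k step i k * value c d k - value c d (place_of i).

Lemma advantage_follow c d j : advantage c d (follow d j) = 0.
Proof.
rewrite /advantage followK /value; case: cid => V VE /=.
by have := VE j; set S := \sum_k _ => ->; ring.
Qed.

(** This is linear programming duality with the values as dual variables: multiply
    the balance equation of every place by the value there and sum. *)
Lemma lin_value c d b (x : index -> R) : conserves b x ->
  lin c x = \sum_j b j * value c d j + \sum_i x i * advantage c d i.
Proof.
move=> xb; set V := value c d.
have out : \sum_i x i * V (place_of i) = \sum_j (\sum_(i | place_of i == j) x i) * V j.
  rewrite (partition_big place_of xpredT) //=; apply: eq_bigr => j _.
  by rewrite mulr_suml; apply: eq_bigr => i /eqP->.
have inn : \sum_i x i * \sum_k step i k * V k = \sum_j (\sum_i step i j * x i) * V j.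
  under eq_bigr do rewrite mulr_sumr.
  rewrite exchange_big /=; apply: eq_bigr => j _; rewrite mulr_suml.
  by apply: eq_bigr => i _; ring.
have -> : \sum_i x i * advantage c d i =
    lin c x + \sum_i x i * \sum_k step i k * V k - \sum_i x i * V (place_of i).
  rewrite /lin -big_split -sumrB /=; apply: eq_bigr => i _.
  by rewrite /advantage -/V; ring.
rewrite out inn; under [X in _ - X]eq_bigr do rewrite xb mulrDl.
rewrite big_split /=; ring.
Qed.

Lemma lin_flow c d b : lin c (flow b d) = \sum_j b j * value c d j.
Proof.
rewrite (lin_value c d (flow_conserves b d)) [X in _ + X]big1 ?addr0 // => i _.
have [->|/flow_off->] := eqVneq i (follow d (place_of i)); last by rewrite mul0r.
by rewrite advantage_follow mulr0.
Qed.

(** All advantages of d vanish along d, so among the indices that the switched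
    selection follows only i contributes. *)
Lemma lin_switch c d b i : lin c (flow b (switch d i)) =
  lin c (flow b d) + flow b (switch d i) i * advantage c d i.
Proof.
rewrite (lin_value c d (flow_conserves b _)) -lin_flow; congr (_ + _).
rewrite (bigD1 i) //= big1 ?addr0 // => k ki.
have [kE|/flow_off->] := eqVneq k (follow (switch d i) (place_of k)); last by rewrite mul0r.
move: kE; rewrite follow_switch; case: eqP => [_ /eqP|_ ->]; first by rewrite (negbTE ki).
by rewrite advantage_follow mulr0.
Qed.
End Network.

(** * Vertices, adjacency and improving neighbours *)

Section Vertices.
Set Implicit Arguments.
Unset Strict Implicit.
Import Order.TTheory GRing.Theory Num.Theory.
Local Open Scope ring_scope.
Context {R : realType} (M : vMDP R).
Local Notation index := (comp_index M).

(** With one unit injected at every place, each place is visited and every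
    profitable switch is a strict improvement.  So a selection that is best for this
    injection has no positive advantage. *)
Lemma unit_flow_switch (c : index -> R) d i : 0 < advantage c d i ->
  lin c (flow (fun=> 1) d) < lin c (flow (fun=> 1) (switch d i)).
Proof.
move=> adv; rewrite lin_switch ltrDl mulr_gt0 //.
have := @flow_ge _ _ (fun=> 1) (switch d i) (place_of i) (fun=> ler01).
by rewrite follow_switch eqxx; exact: lt_le_trans.
Qed.

Lemma profitable_index (c : index -> R) d (y : occupancy M) :
    polyhedron y -> lin c (basic d) < lin c y ->
  exists2 i, 0 < y i & 0 < advantage c d i.
Proof.
move=> [/balancedE yb y_ge0] cy; apply: contrapT => none; move: cy.
rewrite ltNge; apply/negP/negPn.
rewrite (lin_value c d yb) lin_flow -[X in _ <= X]addr0 lerD2l.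
apply: sumr_le0 => i _; rewrite leNgt; apply/negP => term_gt0; apply: none.
have yi : 0 < y i.
  by rewrite lt_def y_ge0 andbT; apply: contraTneq term_gt0 => ->; rewrite mul0r ltxx.
by exists i; rewrite // -(pmulr_rgt0 _ yi).
Qed.

Lemma policy_inhabited : exists d : selection M, true.
Proof.
by exists [ffun ts => Ordinal (nact_ge1 ts.2)].
Qed.

(** The maximum of a linear criterion is attained at a basic solution: take a
    selection that is best for the unit injection. *)
Lemma best_policy (c : index -> R) :
  exists d, forall y : occupancy M, polyhedron y -> lin c y <= lin c (basic d).
Proof.
have [d0 _] := policy_inhabited.
case: (arg_maxP (fun d => lin c (flow (fun=> 1) d)) (erefl (xpredT d0))) => d _ dmax.
exists d => y yP; rewrite leNgt; apply/negP => /(profitable_index yP)[i _ /unit_flow_switch].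
by rewrite ltNge; have /= -> := dmax (switch d i) isT.
Qed.

(** A vertex is the only maximizer of some linear criterion, and one maximizer is a
    basic solution. *)
Lemma vertex_policy (x : occupancy M) : vertex x -> exists d, x = basic d.
Proof.
move=> [c [delta [cmax Fx]]].
have [d dmax] := best_policy c; exists d.
have [xP cx] : polyhedron x /\ lin c x = delta.
  by have : [set x]%classic x by []; rewrite Fx => -[].
have : [set x]%classic (basic d).
  rewrite Fx; split; first exact: basic_polyhedron.
  apply/eqP; rewrite eq_le; apply/andP; split.
    exact: cmax (basic_polyhedron d).
  by rewrite -cx; exact: dmax.
by move->.
Qed.

(** The criterion minus the sum of the coordinates outside A is at most 0 on the
    polyhedron, and 0 only if these coordinates vanish. *)
Lemma support_face (A : {pred index}) :
  face [set x : occupancy M | polyhedron x /\ forall i, i \notin A -> x i = 0]%classic.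
Proof.
exists [ffun i => - (i \notin A)%:R], 0; have term_le0 (x : occupancy M) i :
    polyhedron x -> ([ffun i => - (i \notin A)%:R] : occupancy M) i * x i <= 0.
  by move=> [_ x0]; rewrite ffunE mulNr oppr_le0 mulr_ge0.
split=> [x xP|]; first by apply: sumr_le0 => i _; exact: term_le0.
apply/seteqP; split=> x [xP x0]; split=> //.
  apply: big1 => i _; rewrite ffunE; have [_|/x0->] := boolP (i \in A).
    by rewrite oppr0 mul0r.
  by rewrite mulr0.
move=> i iA; move: x0 => /eqP; rewrite -oppr_eq0 -sumrN psumr_eq0; last first.
  by move=> k _; rewrite oppr_ge0 term_le0.
move=> /allP/(_ i (mem_index_enum _)) /=.
by rewrite ffunE iA mulN1r opprK => /eqP.
Qed.

Lemma policy_vertex (d : selection M) : vertex (basic d).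
Proof.
rewrite /vertex; suff -> : [set basic d]%classic = [set x : occupancy M |
    polyhedron x /\ forall i, i \notin basis d -> x i = 0]%classic.
  exact: (support_face (mem (basis d))).
apply/seteqP; split=> [x /= ->|x /= [[xb x0] xd]].
  have [? ?] := basic_polyhedron d; split=> // i.
  by rewrite notin_basis; exact: flow_off.
by apply/regular_bfsE; split.
Qed.

(** The edge consists of the points that follow d, except that at the place of i
    they divide the mass between the action of d and i.  Such a point is determined
    by its coordinate i, because the difference of two of them with the same
    coordinate i is a flow without injection along d. *)
Lemma adjacent_switch (d : selection M) i : i != follow d (place_of i) ->
  0 < basic (switch d i) i -> adjacent (basic d) (basic (switch d i)).
Proof.
set d' := switch d i => i_off w_gt0.
have v_off := @flow_off _ _ (@supply _ M) d : forall k, _ -> basic d k = 0.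
have vi0 : basic d i = 0 := v_off i i_off.
have w_off k : k != follow d (place_of k) -> k != i -> basic d' k = 0.
  move=> kd ki; apply: flow_off; rewrite follow_switch.
  by case: ifP.
have vw : basic d <> basic d' by move=> vw; move: w_gt0; rewrite -vw vi0 ltxx.
split=> //; try exact: policy_vertex.
pose A := [pred k : index | (k == follow d (place_of k)) || (k == i)].
have AE k : (k \notin A) = (k != follow d (place_of k)) && (k != i).
  by rewrite !inE negb_or.
exists [set x : occupancy M | polyhedron x /\ forall k, k \notin A -> x k = 0]%classic.
have Fv : polyhedron (basic d) /\ forall k, k \notin A -> basic d k = 0.
  split=> [|k]; first exact: basic_polyhedron.
  by rewrite AE => /andP[/v_off].
have Fw : polyhedron (basic d') /\ forall k, k \notin A -> basic d' k = 0.
  split=> [|k]; first exact: basic_polyhedron.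
  by rewrite AE => /andP[]; exact: w_off.
split=> //; split; first exact: support_face.
exists (basic d), (basic d'); split=> // z [[/balancedE zb z_ge0] zA].
pose r := z i / basic d' i; exists r => k.
apply/eqP; rewrite -subr_eq; apply/eqP; move: k.
apply: (@conserves_unique _ _ d (@supply _ M)) => //.
- move=> j; rewrite !sumrB -!mulr_sumr !sumrB zb !flow_conserves.
  under [X in _ = _ + X]eq_bigr do rewrite mulrBr mulrCA mulrBr.
  rewrite !sumrB -!mulr_sumr sumrB; ring.
- move=> {}k kd; rewrite v_off //; have [->|ki] := eqVneq k i.
    by rewrite subr0 divfK ?subrr // gt_eqF.
  by rewrite w_off // zA ?AE ?kd ?ki // subrr mulr0 subrr.
- exact: flow_conserves.
Qed.

(** Among the selections with the same basic solution, the one best for the unit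
    injection has no profitable switch that leaves its basic solution in place. *)
Lemma improving_neighbour (c : index -> R) (d : selection M) (y : occupancy M) :
    polyhedron y -> lin c (basic d) < lin c y ->
  exists2 d', adjacent (basic d) (basic d') & lin c (basic d) < lin c (basic d').
Proof.
move=> yP cy.
case: (arg_maxP (P := fun e => basic e == basic d)
  (fun e => lin c (flow (fun=> 1) e)) (eqxx (basic d))) => e /eqP eX emax.
rewrite -eX in cy *.
have [i yi adv] := profitable_index yP cy.
have i_off : i != follow e (place_of i).
  by apply: contraTneq adv => ->; rewrite advantage_follow ltxx.
(* No mass reaches i after the switch exactly if the place of i is not visited. *)
have [w0|w_gt0] := eqVneq (basic (switch e i) i) 0; last first.
  have {}w_gt0 : 0 < basic (switch e i) i.
    by rewrite lt_def w_gt0 (basic_polyhedron _).2.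
  exists (switch e i); first exact: adjacent_switch.
  by rewrite /basic lin_switch ltrDl mulr_gt0.
have same : basic (switch e i) = basic e.
  apply: flow_unique; first exact: flow_conserves.
  move=> k kd; have [->//|ki] := eqVneq k i.
  by apply: flow_off; rewrite follow_switch; case: ifP.
have := unit_flow_switch adv; rewrite ltNge.
by have /= -> // := emax (switch e i); rewrite same eX.
Qed.
End Vertices.

(** * Efficiency and positive weights *)

Section Efficiency.
Set Implicit Arguments.
Unset Strict Implicit.
Import Order.TTheory GRing.Theory Num.Theory.
Local Open Scope ring_scope.
Context {R : realType} (M : vMDP R).
Local Notation index := (comp_index M).

Definition optimal (c : index -> R) (x : occupancy M) : Prop :=
  polyhedron x /\ forall y : occupancy M, polyhedron y -> lin c y <= lin c x.

Lemma optimal_policies (c : index -> R) (x : occupancy M) : polyhedron x ->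
  (forall d, lin c (basic d) <= lin c x) -> optimal c x.
Proof.
move=> xP xmax; split=> // y /(proj2_sig (cid (best_policy c))) /le_trans; exact.
Qed.

Definition gain (l : 'I_(nobj M)) (i : index) : R :=
  match i with
  | inl (t, sa) => reward t (tagged sa) 0 l
  | inr s => reward_end s 0 l
  end.

Lemma objectiveE (x : occupancy M) l : objective x 0 l = lin (gain l) x.
Proof.
rewrite /objective mxE !summxE /lin sum_index; congr (_ + _).
  apply: eq_bigr => t _; rewrite summxE; apply: eq_bigr => s _.
  by rewrite summxE; apply: eq_bigr => a _; rewrite mxE mulrC.
by apply: eq_bigr => s _; rewrite mxE mulrC.
Qed.

Definition weighted (lam : 'I_(nobj M) -> R) (i : index) : R :=
  \sum_l lam l * gain l i.

Lemma lin_weighted lam (x : occupancy M) :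
  lin (weighted lam) x = \sum_l lam l * objective x 0 l.
Proof.
rewrite /lin; under eq_bigr do rewrite mulr_suml.
rewrite exchange_big; apply: eq_bigr => l _; rewrite objectiveE mulr_sumr.
by apply: eq_bigr => i _; rewrite mulrA.
Qed.

Lemma polyhedron_convex (D : finType) (nu : D -> R) (z : D -> occupancy M) :
    (forall d, 0 <= nu d) -> \sum_d nu d = 1 -> (forall d, polyhedron (z d)) ->
  polyhedron ([ffun i => \sum_d nu d * z d i] : occupancy M).
Proof.
move=> nu0 nu1 zP; split; last first.
  move=> i; rewrite ffunE; apply: sumr_ge0 => d _.
  by rewrite mulr_ge0 //; case: (zP d).
apply/balancedE => j; under eq_bigr do rewrite ffunE.
under [X in _ = _ + X]eq_bigr do rewrite ffunE mulr_sumr.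
rewrite exchange_big [X in _ = _ + X]exchange_big /= -[supply j]mul1r -nu1.
rewrite mulr_suml -big_split; apply: eq_bigr => d _.
have [/balancedE zb _] := zP d; rewrite -mulr_sumr zb mulrDr; congr (_ + _).
by rewrite mulr_sumr; apply: eq_bigr => i _; rewrite mulrCA.
Qed.

Lemma optimal_efficient lam (x : occupancy M) :
  (forall l, 0 < lam l) -> optimal (weighted lam) x -> efficient x.
Proof.
move=> lam_gt0 [xP xmax]; split=> // -[y [yP le_xy]]; apply.
have := xmax y yP; rewrite -subr_ge0 !lin_weighted -sumrB => gap.
have terms l : 0 <= lam l * objective y 0 l - lam l * objective x 0 l.
  by rewrite -mulrBr mulr_ge0 ?subr_ge0 // ltW.
have /eqP : \sum_l (lam l * objective y 0 l - lam l * objective x 0 l) = 0.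
  apply/eqP; rewrite eq_le sumr_ge0 // andbT -oppr_ge0 -sumrN.
  by under eq_bigr do rewrite opprB.
rewrite psumr_eq0 // => /allP eq0; apply/rowP => l.
have := eq0 l (mem_index_enum _); rewrite /= -mulrBr mulf_eq0 gt_eqF //=.
by rewrite subr_eq0 => /eqP.
Qed.

(** If x is efficient, no mixture of the basic solutions dominates it.  Farkas'
    lemma turns the absence of mixing coefficients into weights. *)
Lemma efficient_weights (x : occupancy M) : efficient x ->
  exists2 lam, forall l, 0 < lam l & optimal (weighted lam) x.
Proof.
move=> [xP none].
pose g d l := objective (basic d) 0 l - objective x 0 l.
(* The unknowns are mixing coefficients mu d; the forms say mu d >= 0 and that the
   mixture, before normalization, does not lose in any objective. *)
pose A (k : selection M + 'I_(nobj M)) (d : selection M) : R :=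
  match k with inl d' => - (d == d')%:R | inr l => - g d l end.
have [mu|lam lam_ge0 lamE] := @farkas R _ _ A (fun d => \sum_l g d l) [set: _]%SET.
  move=> Amu.
  have mu_ge0 d : 0 <= mu d.
    have := Amu (inl d) (finset.in_setT _); rewrite /lin (bigD1 d) //= eqxx big1 ?addr0.
      by rewrite mulN1r oppr_le0.
    by move=> d' /negbTE->; rewrite oppr0 mul0r.
  have g_ge0 l : 0 <= \sum_d mu d * g d l.
    have := Amu (inr l) (finset.in_setT _); rewrite /lin /A /= -oppr_ge0 -sumrN.
    by rewrite (eq_bigr (fun d => mu d * g d l)) // => d _; rewrite mulNr opprK mulrC.
  have sumE : lin (fun d => \sum_l g d l) mu = \sum_l \sum_d mu d * g d l.
    rewrite /lin exchange_big /=; apply: eq_bigr => d _.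
    by rewrite mulrC mulr_sumr.
  rewrite sumE leNgt; apply/negP => pos; apply: none.
  have m_ge0 : 0 <= \sum_d mu d by exact: sumr_ge0.
  have m_gt0 : 0 < \sum_d mu d.
    rewrite lt_def m_ge0 andbT psumr_eq0 //; apply: contraTN pos => /allP mu0.
    rewrite big1 ?ltxx // => l _; rewrite big1 // => d _.
    by have /eqP-> := mu0 d (mem_index_enum _); rewrite mul0r.
  set m := \sum_d mu d in m_gt0.
  have nu1 : \sum_d mu d / m = 1 by rewrite -mulr_suml divff ?gt_eqF.
  pose y : occupancy M := [ffun i => \sum_d mu d / m * basic d i].
  have objE l : objective y 0 l - objective x 0 l = m^-1 * \sum_d mu d * g d l.
    have -> : objective y 0 l = \sum_d mu d / m * objective (basic d) 0 l.
      rewrite objectiveE /lin; under eq_bigr do rewrite ffunE mulr_sumr.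
      rewrite exchange_big; apply: eq_bigr => d _; rewrite objectiveE mulr_sumr.
      by apply: eq_bigr => i _; rewrite mulrCA.
    rewrite -[objective x 0 l]mul1r -nu1 mulr_suml -sumrB mulr_sumr.
    by apply: eq_bigr => d _; rewrite /g; ring.
  exists y; split.
  - apply: polyhedron_convex => // [d|d]; last exact: basic_polyhedron.
    by rewrite divr_ge0 // ltW.
  - by move=> l; rewrite -subr_ge0 objE mulr_ge0 // invr_ge0 ltW.
  - move=> yx; move: pos; rewrite big1 ?ltxx // => l _.
    have /eqP := objE l; rewrite yx subrr eq_sym mulf_eq0 invr_eq0 gt_eqF //=.
    by move/eqP.
exists (fun l => 1 + lam (inr l)) => [l|]; first by rewrite ltr_pwDl.
apply: optimal_policies => // d; rewrite !lin_weighted -subr_le0 -sumrB.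
have gE : \sum_l g d l = - lam (inl d) - \sum_l lam (inr l) * g d l.
  rewrite lamE [LHS](eq_bigl xpredT) => [|k]; last by rewrite finset.in_setT.
  rewrite [LHS]big_sumType /= -sumrN; congr (_ + _); last first.
    by apply: eq_bigr => l _; rewrite mulrN.
  rewrite (bigD1 d) //= eqxx mulrN1 big1 ?addr0 // => d' /negbTE dd'.
  by rewrite eq_sym dd' oppr0 mulr0.
have -> : \sum_l ((1 + lam (inr l)) * objective (basic d) 0 l
    - (1 + lam (inr l)) * objective x 0 l) =
    \sum_l g d l + \sum_l lam (inr l) * g d l.
  by rewrite -big_split; apply: eq_bigr => l _; rewrite /g /=; ring.
by rewrite gE subrK oppr_le0.
Qed.

(** * Connectedness of the efficient vertices *)

Lemma small_perturbation (D : finType) (u v : D -> R) :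
  exists2 eps, 0 < eps & forall d, 0 < u d -> eps * v d < u d.
Proof.
pose B := 1 + \sum_(d | 0 < u d) `|v d| / u d.
have S0 : 0 <= \sum_(d | 0 < u d) `|v d| / u d.
  by apply: sumr_ge0 => d ud; rewrite divr_ge0 // ltW.
have B_gt0 : 0 < B by rewrite ltr_pwDl.
exists B^-1 => [|d ud]; first by rewrite invr_gt0.
rewrite mulrC ltr_pdivrMr // mulrC -ltr_pdivrMr //.
apply: (@le_lt_trans _ _ (`|v d| / u d)); first by rewrite ler_pM2r ?invr_gt0 ?ler_norm.
rewrite /B (bigD1 d) //=.
have : 0 <= \sum_(i | (0 < u i) && (i != d)) `|v i| / u i.
  by apply: sumr_ge0 => e /andP[ue _]; rewrite divr_ge0 // ltW.
lra.
Qed.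

(** An improving neighbour for c + eps * g, with eps so small that no vertex that is
    worse for c becomes better, remains optimal for c and improves g. *)
Lemma face_walk (K : occupancy M -> Prop) (c g : index -> R) (d : selection M) :
    (forall e e', K (basic e) -> adjacent (basic e) (basic e') ->
      optimal c (basic e') -> K (basic e')) ->
    K (basic d) -> optimal c (basic d) ->
  exists e, [/\ K (basic e), optimal c (basic e)
    & forall e', optimal c (basic e') -> lin g (basic e') <= lin g (basic e)].
Proof.
move=> Kclosed Kd dopt.
case: (arg_maxP (P := fun e => `[< K (basic e) /\ optimal c (basic e) >])
  (fun e => lin g (basic e)) (introT (asboolP _) (conj Kd dopt))) => e /asboolP[Ke eopt] emax.
exists e; split=> // e' e'opt; rewrite leNgt; apply/negP => lt_g.
have [eps eps_gt0 epsP] := @small_perturbation _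
  (fun k => lin c (basic e) - lin c (basic k)) (fun k => lin g (basic k) - lin g (basic e)).
have ceq : lin c (basic e') = lin c (basic e).
  by apply/eqP; rewrite eq_le eopt.2 ?e'opt.2 //; [exact: eopt.1|exact: e'opt.1].
have [||k adj] := @improving_neighbour R M (fun i => 1 * c i + eps * g i) e (basic e').
- exact: e'opt.1.
- by rewrite !lin_combl ceq ltrD2l ltr_pM2l.
rewrite !lin_combl !mul1r => lt_k.
have kP := basic_polyhedron k.
have ck : lin c (basic k) = lin c (basic e).
  apply/eqP; rewrite eq_le eopt.2 //= leNgt; apply/negP; rewrite -subr_gt0.
  by move=> /epsP; lra.
have kopt : optimal c (basic k) by split=> // y /eopt.2; rewrite ck.
have /= := emax k (introT (asboolP _) (conj (Kclosed _ _ Ke adj kopt) kopt)).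
rewrite leNgt => /negP; apply; move: lt_k; rewrite ck ltrD2l ltr_pM2l //.
Qed.

(** Move the criterion linearly from one for which d0 is optimal to one for which d1
    is, and consider, among the vertices in K that are optimal at some moment, one
    whose value grows at the largest rate.  If it were overtaken before the end, a
    walk in the optimal face at that moment would give a vertex in K whose value
    grows at a larger rate. *)
Lemma efficient_connected (K : occupancy M -> Prop) (d0 d1 : selection M) :
    (forall e e', K (basic e) -> adjacent (basic e) (basic e') ->
      efficient (basic e') -> K (basic e')) ->
    K (basic d0) -> efficient (basic d0) -> efficient (basic d1) ->
  K (basic d1).
Proof.
move=> Kclosed Kd0 /efficient_weights[lam0 lam0_gt0 opt0].
move=> /efficient_weights[lam1 lam1_gt0 opt1].
pose c0 := weighted lam0; pose c1 := weighted lam1.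
pose c t (i : index) := (1 - t) * c0 i + t * c1 i.
(* The rate at which the value of c t grows with t. *)
pose h (i : index) := 1 * c1 i + (-1) * c0 i.
have c_eff t x : 0 <= t <= 1 -> optimal (c t) x -> efficient x.
  move=> /andP[t0 t1].
  have -> : c t = weighted (fun l => (1 - t) * lam0 l + t * lam1 l).
    apply/funext => i; rewrite /c /c0 /c1 /weighted !mulr_sumr -big_split.
    by apply: eq_bigr => l _ /=; ring.
  apply: optimal_efficient => l.
  have [->|t_gt0] := eqVneq t 0; first by rewrite subr0 mul0r addr0 mul1r.
  rewrite ltr_wpDl //; first by rewrite mulr_ge0 ?subr_ge0 // ltW.
  by rewrite mulr_gt0 // lt_def t_gt0.
have Kwalk t : 0 <= t <= 1 -> forall e e', K (basic e) -> adjacent (basic e) (basic e') ->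
    optimal (c t) (basic e') -> K (basic e').
  by move=> t01 e e' Ke adj /(c_eff _ _ t01); exact: Kclosed adj.
have linc t x : lin (c t) x = lin c0 x + t * lin h x.
  by rewrite /c /h !lin_combl; ring.
have linh x : lin h x = lin c1 x - lin c0 x by rewrite /h lin_combl; ring.
pose good e := K (basic e) /\ exists2 t, 0 <= t <= 1 & optimal (c t) (basic e).
have good0 : good d0.
  split=> //; exists 0; rewrite ?lexx ?ler01 //.
  by split=> [|y /opt0.2]; [exact: opt0.1|rewrite !linc !mul0r !addr0].
case: (arg_maxP (P := fun e => `[< good e >]) (fun e => lin h (basic e))
  (introT (asboolP _) good0)) => e /asboolP[Ke [t t01 eopt]] emax.
have {}emax e' : good e' -> lin h (basic e') <= lin h (basic e).
  by move=> ge'; apply: emax; apply/asboolP.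
have d1P := basic_polyhedron d1.
have eP := basic_polyhedron e.
(* Beyond t, a vertex can overtake e only if its rate h is larger; so if d1 has no
   larger rate, then e is optimal at the end t = 1. *)
have [h1|h1] := leP (lin h (basic d1)) (lin h (basic e)).
  have eopt1 : optimal (c 1) (basic e).
    have : lin c1 (basic d1) <= lin c1 (basic e).
      have := eopt.2 _ d1P; rewrite !linc.
      have : (1 - t) * lin h (basic d1) <= (1 - t) * lin h (basic e).
        by rewrite ler_wpM2l // subr_ge0; case/andP: t01.
      by rewrite !mulrBl !mul1r !linh; lra.
    move=> le1; split=> // y /opt1.2.
    by rewrite !linc !mul1r !linh; rewrite -/c1; lra.
  (* Among the optimal vertices of c 1, a walk singles out d1 by a criterion g of
     which d1 is the only maximizer. *)
  have [g [delta [gmax Fg]]] := policy_vertex d1.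
  have [|k [Kk kopt kmax]] := face_walk g (Kwalk 1 _) Ke eopt1.
    by rewrite ler01 lexx.
  have gd1 : lin g (basic d1) = delta.
    by have : [set basic d1]%classic (basic d1) by []; rewrite Fg => -[].
  have : [set basic d1]%classic (basic k).
    rewrite Fg; split; first exact: kopt.1.
    apply/eqP; rewrite eq_le (gmax _ kopt.1) /= -gd1 kmax //.
    by split=> // y /opt1.2; rewrite !linc !mul1r !linh -/c1; lra.
  by move=> <-.
(* The parameter t + ratio w is the one where w catches up with e.  The first w
   to do so is then optimal along with e, and a walk in their common optimal face
   contradicts the choice of e. *)
pose ratio w := (lin (c t) (basic e) - lin (c t) (basic w)) / (lin h (basic w) - lin h (basic e)).
case: (arg_minP (P := fun w => lin h (basic e) < lin h (basic w)) ratio h1) => w hw wmin.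
have ratioE k : lin h (basic e) < lin h (basic k) ->
    ratio k * (lin h (basic k) - lin h (basic e)) = lin (c t) (basic e) - lin (c t) (basic k).
  by move=> hk; rewrite divfK // subr_eq0 gt_eqF.
have r_ge0 : 0 <= ratio w.
  rewrite divr_ge0 // subr_ge0; last exact: ltW.
  exact/eopt.2/basic_polyhedron.
have linct s x : lin (c (t + s)) x = lin (c t) x + s * lin h x.
  by rewrite !linc; ring.
have s01 : 0 <= t + ratio w <= 1.
  rewrite addr_ge0 //=; last by case/andP: t01.
  rewrite -lerBrDl; apply: le_trans (wmin d1 h1) _.
  rewrite ler_pdivrMr ?subr_gt0 // !linc.
  have := opt1.2 _ eP; rewrite -/c1 mulrBl mul1r mulrBr; move: h1.
  rewrite !linh; lra.
have eopt' : optimal (c (t + ratio w)) (basic e).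
  apply: optimal_policies => // k; rewrite !linct.
  have [hk|hk] := leP (lin h (basic k)) (lin h (basic e)).
    have := eopt.2 _ (basic_polyhedron k).
    by have := ler_wpM2l r_ge0 hk; lra.
  have := ratioE k hk; have : 0 <= (ratio k - ratio w) * (lin h (basic k) - lin h (basic e)).
    by rewrite mulr_ge0 ?subr_ge0 ?wmin // ltW.
  by rewrite !mulrBl !mulrBr; lra.
have wopt' : optimal (c (t + ratio w)) (basic w).
  split=> [|y /eopt'.2]; first exact: basic_polyhedron.
  by have := ratioE w hw; rewrite !linct mulrBr; lra.
have [k [Kk kopt kmax]] := face_walk h (Kwalk _ s01) Ke eopt'.
have : good k by split=> //; exists (t + ratio w).
by move=> /emax; rewrite leNgt (lt_le_trans hw) // kmax.
Qed.
End Efficiency.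

(** * The graph search *)

Section Algorithm.
Set Implicit Arguments.
Unset Strict Implicit.
Context {R : realType} (M : vMDP R).

Lemma vertices_ofP (E : {fset node M}) (x : occupancy M) :
  reflect (exists2 nd, nd \in E & x = nd.1) (x \in vertices_of E).
Proof. exact: imfsetP. Qed.

Lemma tests_exist (x : occupancy M) (E : {fset node M}) :
  exists tested, tests x E tested.
Proof.
(* One selection per vertex: [pick] returns the same selection for equal vertices. *)
pose chosen (nd : node M) := [pick e | basic e == nd.1] == Some nd.2.
pose P (nd : node M) :=
  [&& `[< adjacent x nd.1 >], nd.1 \notin vertices_of E & chosen nd].
exists [fset nd in [seq (basic d, d) : node M | d <- enum (selection M)] | P nd]%fset.
have mem nd :
    nd \in [fset nd in [seq (basic d, d) : node M | d <- enum (selection M)] | P nd]%fset ->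
    nd = (basic nd.2, nd.2) /\ P nd.
  by rewrite !inE => /andP[/mapP[d _ ->]].
split=> [nd /mem[ndE /and3P[/asboolP xnd ndE' _]]|y xy yE
  |nd nd' /mem[_ ndP] /mem[_ ndP'] eq1].
- by split=> //; apply/regular_bfsE; rewrite [in LHS]ndE.
- have [_ /vertex_policy[d0 yd0] _ _] := xy.
  case: (pickP (fun e => basic e == y)) => [d /eqP yd|none]; last first.
    by have := none d0; rewrite yd0 eqxx.
  have [e eE] : exists e, [pick e | basic e == y] = Some e.
    by case: pickP => [e _|none]; [exists e|have := none d0; rewrite yd0 eqxx].
  have ye : basic e = y by move: eE; case: pickP => // e' /eqP <- [->].
  apply/vertices_ofP; exists (basic e, e) => //=; rewrite !inE /=.
  apply/andP; split; first by apply/mapP; exists e; rewrite ?mem_enum.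
  by rewrite /P /chosen /= ye yE eE eqxx !andbT; apply/asboolP.
- move: ndP ndP' => /and3P[_ _ /eqP c1] /and3P[_ _ /eqP c2].
  by case: nd nd' eq1 c1 c2 => [y d] [y' d'] /= -> -> [->].
Qed.

(** After n iterations exactly n of the nodes found are no longer pending, since the
    nodes added are always new; this bounds the number of iterations. *)
Record invariant (x0 : occupancy M) (n : nat) (st : alg_state M) : Prop := Invariant {
  inv_card : #|` found st| = (#|` pending st| + n)%N;
  inv_pending : (pending st `<=` found st)%fset;
  inv_start : x0 \in vertices_of (found st);
  inv_found : forall nd, nd \in found st -> regular_bfs nd.2 nd.1 /\ efficient nd.1;
  inv_inj : {in found st &, injective (fun nd : node M => nd.1)};
  inv_done : forall nd, nd \in found st -> nd \notin pending st ->
    forall y, adjacent nd.1 y -> efficient y -> y \in vertices_of (found st)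
}.

Lemma invariant_initial (nd : node M) : regular_bfs nd.2 nd.1 -> efficient nd.1 ->
  invariant nd.1 0 (initial nd).
Proof.
move=> reg eff; split=> /=.
- by rewrite addn0.
- exact: fsubset_refl.
- by apply/vertices_ofP; exists nd; rewrite ?inE.
- by move=> nd'; rewrite inE => /eqP->.
- by move=> nd1 nd2; rewrite !inE => /eqP-> /eqP->.
- by move=> nd' ->.
Qed.

Lemma invariant_pass x0 n nd st st' :
  invariant x0 n st -> pass nd st st' -> invariant x0 n.+1 st'.
Proof.
move=> [card sub start foundP inj closed] [nd_pending [tested [testedP testedC testedI] ->]].
set new := [fset nd' in tested | `[< efficient nd'.1 >]]%fset.
have newP nd' : nd' \in new -> nd' \in tested /\ efficient nd'.1.
  by rewrite !inE => /andP[? /asboolP].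
have grow y : y \in vertices_of (found st) -> y \in vertices_of (found st `|` new)%fset.
  by move=> /vertices_ofP[nd' nd'E ->]; apply/vertices_ofP; exists nd'; rewrite // inE nd'E.
have fresh nd' : nd' \in new -> nd'.1 \notin vertices_of (found st).
  by move=> /newP[/testedP[]].
have found_new nd' : nd' \in new -> nd' \notin found st.
  move=> /fresh; apply: contra => nd'E; apply/vertices_ofP; by exists nd'.
have disj : [disjoint found st & new]%fset.
  by apply/fdisjointP => nd' nd'E; apply/negP => /found_new; rewrite nd'E.
have disj' : [disjoint pending st `\ nd & new]%fset.
  apply: fdisjointWl disj; apply: fsubset_trans sub; exact: fsubsetDl.
split=> /=.
- rewrite !cardfsU (eqP disj) (eqP disj') cardfs0 !subn0 card.
  by rewrite (cardfsD1 nd) nd_pending add1n !addSn addnS addnAC.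
- by rewrite fsetSU // (fsubset_trans _ sub) // fsubsetDl.
- exact: grow.
- move=> nd'; rewrite in_fsetU => /orP[/foundP //|/newP[/testedP[_ _ ?] ?]]; by split.
- move=> nd1 nd2; rewrite !in_fsetU => /orP[E1|E1] /orP[E2|E2] eq1.
  + exact: inj.
  + by have /negP[] := fresh _ E2; rewrite -eq1; apply/vertices_ofP; exists nd1.
  + by have /negP[] := fresh _ E1; rewrite eq1; apply/vertices_ofP; exists nd2.
  + by apply: testedI => //; [exact: (newP _ E1).1|exact: (newP _ E2).1].
- move=> nd1; rewrite in_fsetU => /orP[E1|E1 /negP[]]; last by rewrite in_fsetU E1 orbT.
  rewrite in_fsetU negb_or !inE negb_and negbK => /andP[done1 _] y adj effy.
  have [nd1E|ne] := eqVneq nd1 nd; last first.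
    by apply: grow; apply: closed E1 _ _ adj effy; move: done1; rewrite (negbTE ne).
  rewrite nd1E in adj.
  have [/grow //|yE] := boolP (y \in vertices_of (found st)).
  have /vertices_ofP[nd' nd'T yE'] := testedC _ adj yE.
  apply/vertices_ofP; exists nd' => //; rewrite in_fsetU; apply/orP; right.
  by rewrite !inE nd'T /=; apply/asboolP; rewrite -yE'.
Qed.

Lemma invariant_reachable nd st : regular_bfs nd.2 nd.1 -> efficient nd.1 ->
  reachable (initial nd) st -> exists n, invariant nd.1 n st.
Proof.
move=> reg eff; elim=> [|st1 st2 nd' _ [n inv] step].
  by exists 0%N; exact: invariant_initial.
by exists n.+1; exact: invariant_pass step.
Qed.

Lemma card_found x0 n st : invariant x0 n st -> (#|` found st| <= #|selection M|)%N.
Proof.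
move=> [_ _ _ foundP _ _].
have sub : (found st `<=` [fset nd in [seq (basic d, d) : node M | d <- enum (selection M)]])%fset.
  apply/fsubsetP => -[x d] /foundP[/regular_bfsE /= -> _].
  by rewrite inE; apply/mapP; exists d; rewrite ?mem_enum.
apply: leq_trans (fsubset_leq_card sub) _; rewrite card_fseq.
by rewrite (leq_trans (size_undup _)) // size_map -cardE.
Qed.

(** With nothing pending, the set found is closed under efficient neighbours. *)
Lemma found_complete x0 n st : vertex x0 -> efficient x0 ->
  invariant x0 n st -> pending st = fset0 ->
  forall x, x \in vertices_of (found st) <-> vertex x /\ efficient x.
Proof.
move=> x0_vertex x0_eff [_ _ start foundP _ closed] pending0 x; split.
  move=> /vertices_ofP[nd /foundP[/regular_bfsE ndE eff] ->].
  by split=> //; rewrite ndE; exact: policy_vertex.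
move=> [/vertex_policy[d xd]]; rewrite {}xd.
have [d0 x0d] := vertex_policy x0_vertex; rewrite x0d in start x0_eff.
apply: (@efficient_connected R M (fun x => x \in vertices_of (found st))) start x0_eff.
move=> e e' /vertices_ofP[nd ndE eE]; rewrite eE => adj; apply: closed adj => //.
by rewrite pending0 inE.
Qed.
End Algorithm.

Theorem proposition7p5 (R : realType) (M : vMDP R)
    (x0 : occupancy M) (d0 : selection M)
    (x0_vertex : vertex x0) (x0_efficient : efficient x0)
    (x0_regular : regular_bfs d0 x0) :
  let st0 := initial (x0, d0) in
  (* no execution runs forever *)
  [/\ ~ (exists run : nat -> alg_state M,
           run 0%N = st0 /\
           forall n, exists nd, pass nd (run n) (run n.+1)),
  (* no execution gets stuck, whichever pending vertex is chosen *)
      forall st, reachable st0 st -> forall nd, nd \in pending st ->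
        exists st', pass nd st st'
  (* correctness of the set returned *)
    & forall st, reachable st0 st -> pending st = fset0 ->
        [/\ forall x : occupancy M,
              x \in vertices_of (found st) <-> vertex x /\ efficient x,
            forall nd, nd \in found st -> regular_bfs nd.2 nd.1
          & {in found st &, injective (fun nd : node M => nd.1)}]].
Proof.
move=> st0; split.
- move=> [run [run0 runS]].
  have inv n : invariant x0 n (run n).
    elim: n => [|n IHn]; first by rewrite run0; exact: (@invariant_initial _ _ (x0, d0)).
    by have [nd] := runS n; exact: invariant_pass.
  have := card_found (inv #|selection M|.+1).
  by rewrite (inv_card (inv _)) addnS leqNgt ltnS leq_addl.
- move=> st _ nd nd_pending.
  have [tested testedP] := tests_exist nd.1 (found st).
  by eexists; split=> //; exists tested.
- move=> st reach pending0.
  have [n inv] := @invariant_reachable _ _ (x0, d0) st x0_regular x0_efficient reach.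
  split; first exact: found_complete inv pending0.
    by move=> nd /(inv_found inv)[].
  exact: inv_inj inv.
Qed.
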